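(* For all $n,m\in\mathbb{N}$, the assignment $[f]\mapsto\llbracket f\rrbracket$ is a well-defined bijection from the hom-set $\mathrm{Syn}(\mathcal{T}_{\mathrm{KL}\oplus})(n,m)$ onto the set of all $m\times n$ stochastic matrices, and it is an isometry: for all terms $f,g:n\to m$, $d^{\mathrm{KL}\oplus}(f,g)=\mathrm{KL}_{\max}(\llbracket f\rrbracket,\llbracket g\rrbracket)$.
   Context: $\mathsf{FStoch}^\oplus$ is the symmetric monoidal category whose objects are natural numbers, whose morphisms $n\to m$ are $m\times n$ column-stochastic matrices (for $n=0$ or $m=0$ the empty matrix where it exists), with matrix-multiplication composition and monoidal product the direct sum $A\oplus B=\begin{pmatrix}A&0\\0&B\end{pmatrix}$. For distributions $\mu,\nu$ on a finite set, $\mathrm{KL}(\mu,\nu)=\sum_x\mu(x)\log\frac{\mu(x)}{\nu(x)}$ with conventions $\log\frac a0=\infty$, $0\cdot\infty=0$. For $m\times n$ stochastic matrices, $\mathrm{KL}_{\max}(A,B)=\max_i\mathrm{KL}(A_i,B_i)$ over columns, and $0$ if $n$ or $m$ is $0$. Write $\mathrm{kl}(p,q)=p\log\frac pq+(1-p)\log\frac{1-p}{1-q}$. $\Sigma_{\mathrm{CA}}$ is the monoidal signature with one sort and generators $\eta:0\to1$, $\mu:2\to1$ and $c_p:1\to2$ for each $p\in[0,1]$; terms are built from generators, identities, symmetries, $;$ and $\otimes$, modulo the laws of symmetric strict monoidal categories. $\llbracket-\rrbracket$ is the symmetric monoidal functor into $\mathsf{FStoch}^\oplus$ (sending $\otimes$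 to $\oplus$) with $\llbracket\eta\rrbracket$ the empty $1\times0$ matrix, $\llbracket\mu\rrbracket=(1\ 1)$ and $\llbracket c_p\rrbracket=\begin{pmatrix}p\\1-p\end{pmatrix}$. $\mathcal{T}_{\mathrm{CA}}$ is the monoidal theory of convex algebras of Fritz: a fixed set of equations such that (known result) two terms are equal modulo the congruence generated by these equations and the monoidal laws iff they have the same interpretation, and every morphism of $\mathsf{FStoch}^\oplus$ is the interpretation of a term. The theory $\mathcal{T}_{\mathrm{KL}\oplus}$ over $\Sigma_{\mathrm{CA}}$ has as axioms: every equation of $\mathcal{T}_{\mathrm{CA}}$ (no premises); $f=_0f$ for every term $f$; (Chain$_\oplus$) for all $f,g:1\to n$, $f',g':1\to m$, $p,q\in[0,1]$, $\varepsilon,\delta\in[0,\infty]$: from $f=_\varepsilon g$ and $f'=_\delta g'$ infer $c_p;(f\otimes f')=_{\mathrm{kl}(p,q)+p\varepsilon+(1-p)\delta}c_q;(g\otimes g')$; (Parmax) for all $f,g:n\to m$, $f',g':n'\to m'$: from $f=_\varepsilon g$ and $f'=_\delta g'$ infer $f\otimes f'=_{\max\{\varepsilon,\delta\}}g\otimes g'$. Derivability ($\vdash$) means existence of a well-founded (possibly infinitely branching) proof tree with no open leaves using: the axioms; reflexivity, symmetry, transitivity of $=$ and its congruence with $;$ and $\otimes$; the monoidal laws as equations; replacement of a term by an equal one in either side of $f=_\varepsilon g$; monotonicity (from $f=_\varepsilon g$ infer $f=_{\varepsilon'}g$ for $\varepsilon\le\varepsilon'$); continuity (from $f=_{\varepsilon_i}g$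 for all $i\in I$ infer $f=_{\inf_i\varepsilon_i}g$); nonexpansiveness (from $f=_\varepsilon f'$, $g=_\delta g'$ infer $f;g=_{\varepsilon+\delta}f';g'$ and $f\otimes g=_{\varepsilon+\delta}f'\otimes g'$). The syntactic category $\mathrm{Syn}(\mathcal{T}_{\mathrm{KL}\oplus})$ has hom-sets consisting of terms $n\to m$ modulo $f\equiv g\iff\ \vdash f=g$, with distance $d^{\mathrm{KL}\oplus}(f,g)=\inf\{\varepsilon\in[0,\infty]\mid\ \vdash f=_\varepsilon g\}$. *)

(* Defs.v *)
From HB Require Import structures.
From mathcomp Require Import all_boot all_order all_algebra.
From mathcomp Require Import all_classical all_reals all_analysis.

Set Implicit Arguments.
Unset Strict Implicit.
Unset Printing Implicit Defensive.

Import Order.TTheory GRing.Theory Num.Theory.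

Local Open Scope classical_set_scope.
Local Open Scope ring_scope.

(* Stochastic matrices act on columns.  For n = 0 the empty matrix is
   stochastic; for m = 0 < n the set is empty, as an empty sum is not 1. *)
Definition stochastic (R : realType) (m n : nat) : set 'M[R]_(m, n) :=
  [set A | (forall i j, 0 <= A i j) /\ (forall j, \sum_i A i j = 1)].
Arguments stochastic : clear implicits.

Section Divergence.
Variable R : realType.
Local Open Scope ereal_scope.

(* The test implements log (a / 0) = +oo, also for a = 0.  When b != 0,
   lne 0 = -oo; products follow 0 * +oo = 0 * -oo = 0. *)
Definition log_ratio (a b : R) : \bar R :=
  if b == 0%R then +oo else lne ((a / b)%R%:E).

Definition KL (X : finType) (mu nu : X -> R) : \bar R :=
  \sum_(x : X) (mu x)%:E * log_ratio (mu x) (nu x).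

Definition KLmax (m n : nat) (A B : 'M[R]_(m, n)) : \bar R :=
  if (n == 0%N) || (m == 0%N) then 0
  else \big[maxe/-oo]_(j < n) KL (fun i => A i j) (fun i => B i j).

Definition kl (p q : R) : \bar R :=
  p%:E * log_ratio p q + (1 - p)%R%:E * log_ratio (1 - p)%R (1 - q)%R.

End Divergence.

(* Raw terms; the laws of symmetric strict monoidal categories are imposed by
   the provability relations below. *)
Inductive term (R : realType) : nat -> nat -> Type :=
| Eta : term R 0 1
| Mu : term R 2 1
| Conv (p : {i01 R}) : term R 1 2
| Id (n : nat) : term R n n
| Swap (n m : nat) : term R (n + m) (m + n)
| Seq (n m k : nat) (f : term R n m) (g : term R m k) : term R n k
| Par (n m n' m' : nat) (f : term R n m) (f' : term R n' m') :
    term R (n + n') (m + m').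

Arguments Eta {R}.
Arguments Mu {R}.
Arguments Id {R} n.
Arguments Swap {R} n m.

Declare Scope tm_scope.
Delimit Scope tm_scope with tm.
Bind Scope tm_scope with term.
Notation "f ;; g" := (Seq f g) (at level 50, left associativity) : tm_scope.
Notation "f ⊗ g" := (Par f g) (at level 40, left associativity) : tm_scope.

Definition castT (R : realType) (n m n' m' : nat)
    (eqnm : (n = n') * (m = m')) (f : term R n m) : term R n' m' :=
  let: erefl in _ = n' := eqnm.1 return term R n' m' in
  let: erefl in _ = m' := eqnm.2 return term R n m' in f.

(* Composition is in diagrammatic order, hence the reversed product. *)
Fixpoint sem (R : realType) (n m : nat) (f : term R n m) : 'M[R]_(m, n) :=
  match f in term _ n m return 'M[R]_(m, n) with
  | Eta => 0
  | Mu => const_mx 1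
  | Conv p => \col_(i < 2) (if i == ord0 then p%:num else 1 - p%:num)
  | Id n => 1%:M
  | Swap n m => block_mx 0 1%:M 1%:M 0
  | Seq _ _ _ f g => sem g *m sem f
  | Par _ _ _ _ f f' => block_mx (sem f) 0 0 (sem f')
  end.

Definition equations (R : realType) :=
  forall n m : nat, term R n m -> term R n m -> Prop.

Section Laws.
Variable R : realType.
Local Open Scope tm_scope.

Inductive monoidal_law : equations R :=
| seqA n m k l (f : term R n m) (g : term R m k) (h : term R k l) :
    monoidal_law (f ;; (g ;; h)) (f ;; g ;; h)
| seq1f n m (f : term R n m) : monoidal_law (Id n ;; f) f
| seqf1 n m (f : term R n m) : monoidal_law (f ;; Id m) f
| parA n m n' m' n'' m''
    (f : term R n m) (f' : term R n' m') (f'' : term R n'' m'') :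
    monoidal_law (castT (addnA n n' n'', addnA m m' m'') (f ⊗ (f' ⊗ f'')))
                 (f ⊗ f' ⊗ f'')
| par0f n m (f : term R n m) :
    monoidal_law (castT (add0n n, add0n m) (Id 0 ⊗ f)) f
| parf0 n m (f : term R n m) :
    monoidal_law (castT (addn0 n, addn0 m) (f ⊗ Id 0)) f
| par1 n m : monoidal_law (Id n ⊗ Id m) (Id (n + m))
| interchange n m k n' m' k'
    (f : term R n m) (g : term R m k) (f' : term R n' m') (g' : term R m' k') :
    monoidal_law ((f ;; g) ⊗ (f' ;; g')) ((f ⊗ f') ;; (g ⊗ g'))
| swapK n m : monoidal_law (Swap n m ;; Swap m n) (Id (n + m))
| swap_nat n m n' m' (f : term R n m) (f' : term R n' m') :
    monoidal_law ((f ⊗ f') ;; Swap m m') (Swap n n' ;; (f' ⊗ f))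
| swapD n m k :
    monoidal_law
      (Swap n (m + k))
      (castT (esym (addnA n m k), esym (addnA m n k)) (Swap n m ⊗ Id k) ;;
       castT (erefl, addnA m k n) (Id m ⊗ Swap n k)).

Inductive eqmod (E : equations R) : equations R :=
| eqmod_ax n m (f g : term R n m) : E n m f g -> eqmod E f g
| eqmod_law n m (f g : term R n m) : monoidal_law f g -> eqmod E f g
| eqmod_refl n m (f : term R n m) : eqmod E f f
| eqmod_sym n m (f g : term R n m) : eqmod E f g -> eqmod E g f
| eqmod_trans n m (f g h : term R n m) :
    eqmod E f g -> eqmod E g h -> eqmod E f h
| eqmod_seq n m k (f f' : term R n m) (g g' : term R m k) :
    eqmod E f f' -> eqmod E g g' -> eqmod E (f ;; g) (f' ;; g')
| eqmod_par n m n' m' (f f' : term R n m) (g g' : term R n' m') :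
    eqmod E f f' -> eqmod E g g' -> eqmod E (f ⊗ g) (f' ⊗ g').

(* The convex-algebra theory is represented by any set of equations E that is
   sound and complete for stochastic matrices, as Fritz's presentation is. *)
Definition axiomatises_stochastic (E : equations R) : Prop :=
  forall n m (f g : term R n m), eqmod E f g <-> sem f = sem g.

Inductive judgment (n m : nat) : Type :=
| JEq (f g : term R n m)
| JQEq (e : \bar R) (f g : term R n m).

Notation "f ≡ g" := (JEq f g) (at level 70).
Notation "f ≡[ e ] g" := (JQEq e f g) (at level 70, e at next level).

(* Indices range over \bar R without a sign condition: kl is nonnegative on
   [0, 1], so no rule introduces a negative index.  In q_cont the index type
   may be empty, the infimum then being +oo. *)
Inductive derivable (E : equations R) : forall n m, judgment n m -> Prop :=
| d_ax n m (f g : term R n m) : E n m f g -> derivable E (f ≡ g)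
| d_law n m (f g : term R n m) : monoidal_law f g -> derivable E (f ≡ g)
| d_refl n m (f : term R n m) : derivable E (f ≡ f)
| d_sym n m (f g : term R n m) : derivable E (f ≡ g) -> derivable E (g ≡ f)
| d_trans n m (f g h : term R n m) :
    derivable E (f ≡ g) -> derivable E (g ≡ h) -> derivable E (f ≡ h)
| d_seq n m k (f f' : term R n m) (g g' : term R m k) :
    derivable E (f ≡ f') -> derivable E (g ≡ g') ->
    derivable E (f ;; g ≡ f' ;; g')
| d_par n m n' m' (f f' : term R n m) (g g' : term R n' m') :
    derivable E (f ≡ f') -> derivable E (g ≡ g') ->
    derivable E (f ⊗ g ≡ f' ⊗ g')
| q_refl n m (f : term R n m) : derivable E (f ≡[0%E] f)
| q_chain n m (f g : term R 1 n) (f' g' : term R 1 m) (p q : {i01 R})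
    (e d : \bar R) :
    derivable E (f ≡[e] g) -> derivable E (f' ≡[d] g') ->
    derivable E
      (Conv p ;; (f ⊗ f')
       ≡[(kl p%:num q%:num + p%:num%:E * e + (1 - p%:num)%:E * d)%E]
       Conv q ;; (g ⊗ g'))
| q_parmax n m n' m' (f g : term R n m) (f' g' : term R n' m')
    (e d : \bar R) :
    derivable E (f ≡[e] g) -> derivable E (f' ≡[d] g') ->
    derivable E (f ⊗ f' ≡[maxe e d] g ⊗ g')
| q_repl n m (f f' g g' : term R n m) (e : \bar R) :
    derivable E (f ≡ f') -> derivable E (g ≡ g') ->
    derivable E (f ≡[e] g) -> derivable E (f' ≡[e] g')
| q_mono n m (f g : term R n m) (e e' : \bar R) :
    (e <= e')%E -> derivable E (f ≡[e] g) -> derivable E (f ≡[e'] g)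
| q_cont n m (f g : term R n m) (I : Type) (e : I -> \bar R) :
    (forall i, derivable E (f ≡[e i] g)) ->
    derivable E (f ≡[ereal_inf (range e)] g)
| q_seq n m k (f f' : term R n m) (g g' : term R m k) (e d : \bar R) :
    derivable E (f ≡[e] f') -> derivable E (g ≡[d] g') ->
    derivable E (f ;; g ≡[(e + d)%E] f' ;; g')
| q_par n m n' m' (f f' : term R n m) (g g' : term R n' m')
    (e d : \bar R) :
    derivable E (f ≡[e] f') -> derivable E (g ≡[d] g') ->
    derivable E (f ⊗ g ≡[(e + d)%E] f' ⊗ g').

Definition dKL (E : equations R) n m (f g : term R n m) : \bar R :=
  ereal_inf [set e | (0 <= e)%E /\ derivable E (JQEq e f g)].

End Laws.

HB.instance Definition _ (R : realType) n m := gen_eqMixin (term R n m).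
HB.instance Definition _ (R : realType) n m := gen_choiceMixin (term R n m).

Section SyntacticCategory.
Variables (R : realType) (E : equations R) (n m : nat).

Definition syn_rel : rel (term R n m) :=
  fun f g => `[< derivable E (JEq f g) >].

Lemma syn_rel_refl : reflexive syn_rel.
Proof. by move=> f; apply/asboolP; exact: d_refl. Qed.

Lemma syn_rel_sym : symmetric syn_rel.
Proof. by move=> f g; apply/asboolP/asboolP; exact: d_sym. Qed.

Lemma syn_rel_trans : transitive syn_rel.
Proof.
by move=> g f h /asboolP fg /asboolP gh; apply/asboolP; exact: d_trans gh.
Qed.

Canonical syn_equiv := EquivRel syn_rel syn_rel_refl syn_rel_sym syn_rel_trans.

Definition Syn := {eq_quot syn_equiv}%qT.

Definition syn_class (f : term R n m) : Syn := (\pi_Syn f)%qT.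

End SyntacticCategory.

(* Main.v *)
Require Import Defs.
From mathcomp Require Import all_boot all_order all_algebra.
From mathcomp Require Import all_classical all_reals all_analysis.
From mathcomp Require Import ring lra zify.

(* Soundness: each rule is validated columnwise.  The chain rule of relative
   entropy, in the pointwise form [relentM], gives (Chain) with equality, and
   combined with the log-sum inequality it gives
   KL(G u, G' u') <= KL(u, u') + sum_l u_l KL(G_l, G'_l),
   which is nonexpansiveness of composition.
   Completeness: a distribution on m + 1 points is a convex combination of a
   Dirac mass and a distribution on m points, so iterating (Chain) derives the
   exact divergence of two columns.  A matrix with several columns is the
   parallel product of its columns followed by a codiagonal m + m -> m, so
   (Parmax) derives the maximum of the column divergences; the codiagonal is
   the same on both sides and costs nothing. *)

Set Implicit Arguments.
Unset Strict Implicit.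
Unset Printing Implicit Defensive.

Import Order.TTheory GRing.Theory Num.Theory.

Local Open Scope ring_scope.

(** * Relative entropy: pointwise form, log-sum inequality, chain rule *)

Section RelativeEntropy.
Variable R : realType.
Implicit Types a b p q t : R.

Definition relent a b : \bar R := (a%:E * log_ratio a b)%E.

Lemma relent0l b : relent 0 b = 0%E.
Proof. by rewrite /relent mul0e. Qed.

Lemma relent0r a : 0 < a -> relent a 0 = +oo%E.
Proof. by move=> a0; rewrite /relent /log_ratio eqxx gt0_muley. Qed.

Lemma relentE a b : 0 < a -> 0 < b -> relent a b = (a * ln (a / b))%:E.
Proof.
by move=> a0 b0; rewrite /relent /log_ratio gt_eqF// lne_EFin ?divr_gt0.
Qed.

Lemma relentxx a : 0 <= a -> relent a a = 0%E.
Proof.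
rewrite le_eqVlt => /predU1P[<-|a0]; first exact: relent0l.
by rewrite relentE// divff ?gt_eqF// ln1 mulr0.
Qed.

(* The right-hand side is the tangent at [a / b = t] of the convex map
   [a |-> a ln (a / b)]. *)
Lemma relent_tangent a b t : 0 <= a -> 0 <= b -> 0 < t ->
  ((a * ln t + a - b * t)%:E <= relent a b)%E.
Proof.
rewrite le_eqVlt => /predU1P[<- b0 t0|a0].
  by rewrite relent0l mul0r !add0r lee_fin oppr_le0 mulr_ge0// ltW.
rewrite le_eqVlt => /predU1P[<- _|b0 t0]; first by rewrite relent0r ?leey.
rewrite relentE// lee_fin.
have x0 : 0 < b * t / a by rewrite divr_gt0 ?mulr_gt0.
have : ln (b * t / a) <= b * t / a - 1.
  have := @le_ln1Dx R (b * t / a - 1).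
  by rewrite addrCA subrr addr0; apply; lra.
rewrite lnM ?posrE ?mulr_gt0 ?invr_gt0// lnM ?posrE// !lnM ?posrE ?invr_gt0//.
rewrite !lnV ?posrE// => h.
have : a * (ln b + ln t - ln a) <= a * (b * t / a - 1) by rewrite ler_pM2l.
have -> : a * (b * t / a - 1) = b * t - a by field; rewrite gt_eqF.
by lra.
Qed.

Lemma relent_gtNy a b : 0 <= a -> 0 <= b -> (-oo < relent a b)%E.
Proof.
by move=> a0 b0; apply: lt_le_trans (relent_tangent a0 b0 ltr01); rewrite ltNyr.
Qed.

(** The side condition under which the other summand, if [+oo], absorbs this one. *)
Lemma mul_relent_neqNy c a b : 0 <= c -> 0 <= a -> 0 <= b ->
  (c%:E * relent a b != -oo)%E.
Proof.
move=> c0 a0 b0; rewrite -ltNye.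
have : (-oo < relent a b)%E by exact: relent_gtNy.
case: (relent a b) => [r _|_|//]; first by rewrite -EFinM ltNyr.
by apply: (@lt_le_trans _ _ 0%E); rewrite // mule_ge0.
Qed.

(** The logarithm of a product splits. If [p] or [a] is 0, both sides vanish; otherwise, if [q] or
    [b] is 0, both are [+oo]. *)
Lemma relentM p q a b : 0 <= p -> 0 <= q -> 0 <= a -> 0 <= b ->
  relent (p * a) (q * b) = (a%:E * relent p q + p%:E * relent a b)%E.
Proof.
move=> p0 q0 a0 b0.
have [->|pn0] := eqVneq p 0; first by rewrite mul0r !relent0l mule0 mul0e adde0.
have [->|an0] := eqVneq a 0; first by rewrite mulr0 !relent0l mule0 mul0e adde0.
have {}p0 : 0 < p by rewrite lt_def pn0.
have {}a0 : 0 < a by rewrite lt_def an0.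
have [->|qn0] := eqVneq q 0.
  rewrite mul0r !relent0r ?mulr_gt0// gt0_muley// addye//.
  by rewrite mul_relent_neqNy// ltW.
have [->|bn0] := eqVneq b 0.
  rewrite mulr0 !relent0r ?mulr_gt0// gt0_muley// addey//.
  by rewrite mul_relent_neqNy// ltW.
have {}q0 : 0 < q by rewrite lt_def qn0.
have {}b0 : 0 < b by rewrite lt_def bn0.
rewrite !relentE ?mulr_gt0// -!EFinM -EFinD; congr EFin.
have -> : p * a / (q * b) = (p / q) * (a / b) by field; rewrite !gt_eqF.
by rewrite lnM ?posrE ?divr_gt0//; ring.
Qed.

(** All tangents are taken at the common ratio [t = A / B]; in their sum the corrections [A] and
    [- B * t] cancel. *)
Lemma log_sum (I : finType) (a b : I -> R) :
  (forall i, 0 <= a i) -> (forall i, 0 <= b i) ->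
  (relent (\sum_i a i) (\sum_i b i) <= \sum_i relent (a i) (b i))%E.
Proof.
move=> a0 b0; set A := \sum_i a i; set B := \sum_i b i.
have A0 : 0 <= A by exact: sumr_ge0.
have B0 : 0 <= B by exact: sumr_ge0.
have [A_eq0|An0] := eqVneq A 0.
  rewrite A_eq0 relent0l; apply: sume_ge0 => i _.
  suff -> : a i = 0 by rewrite relent0l.
  exact: psumr_eq0P A_eq0 _ _.
have {}A0 : 0 < A by rewrite lt_def An0.
(* If [B = 0], every [b i] vanishes while some [a i] is positive, so one summand is [+oo] and none
   is [-oo]. *)
have [B_eq0|Bn0] := eqVneq B 0.
  have bE i : b i = 0 by exact: psumr_eq0P B_eq0 _ _.
  have -> : (\sum_i relent (a i) (b i) = +oo)%E; last by rewrite leey.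
  apply/eqP; rewrite esum_eqy; last first.
    by move=> i _; rewrite -ltNye relent_gtNy.
  apply/existsP.
  have [/existsP[i ai]|/existsPn ha] := boolP [exists i, 0 < a i].
    by exists i; rewrite bE relent0r.
  move: An0; rewrite /A big1 ?eqxx// => i _; apply/eqP.
  by rewrite eq_le a0 andbT leNgt ha.
have {}B0 : 0 < B by rewrite lt_def Bn0.
apply: (@le_trans _ _ (\sum_i (a i * ln (A / B) + a i - b i * (A / B))%:E)%E).
  rewrite sumEFin relentE// lee_fin !big_split/= sumrN -!mulr_suml -/A -/B.
  by rewrite [B * _]mulrC divfK// addrK.
by apply: lee_sum => i _; apply: relent_tangent; rewrite ?divr_gt0.
Qed.

Lemma KLE (X : finType) (f g : X -> R) : KL f g = (\sum_x relent (f x) (g x))%E.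
Proof. by []. Qed.

Lemma KL_ge0 (X : finType) (f g : X -> R) :
  (forall x, 0 <= f x) -> (forall x, 0 <= g x) ->
  \sum_x f x = 1 -> \sum_x g x = 1 -> (0 <= KL f g)%E.
Proof.
move=> f0 g0 f1 g1; have := log_sum f0 g0.
by rewrite f1 g1 relentxx.
Qed.

Lemma KLM (X : finType) (p q : R) (f g : X -> R) : 0 <= p -> 0 <= q ->
  (forall x, 0 <= f x) -> (forall x, 0 <= g x) ->
  KL (fun x => p * f x) (fun x => q * g x) =
  ((\sum_x f x)%:E * relent p q + p%:E * KL f g)%E.
Proof.
move=> p0 q0 f0 g0; rewrite !KLE.
under eq_bigr do rewrite relentM//.
(* Distributivity in the extended reals: the coefficients [f x] are nonnegative, and no
   [relent (f x) (g x)] is [-oo]. *)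
rewrite big_split/= -ge0_sume_distrl; last by move=> i _; rewrite lee_fin.
rewrite sumEFin fin_num_sume_distrr// => x y _ _.
by rewrite ltninfty_adde_def// inE relent_gtNy.
Qed.

(** Passing from the joint law of the intermediate point [l] and the output [i] to the law of [i]
    does not increase divergence; the joint divergence splits by [KLM]. *)
Lemma KL_mulmx m n k (G G' : 'M[R]_(m, n)) (F F' : 'M[R]_(n, k)) j :
  stochastic R m n G -> stochastic R m n G' ->
  stochastic R n k F -> stochastic R n k F' ->
  (KL (fun i => (G *m F) i j) (fun i => (G' *m F') i j) <=
   KL (fun l => F l j) (fun l => F' l j) +
   \sum_l (F l j)%:E * KL (fun i => G i l) (fun i => G' i l))%E.
Proof.
move=> [G0 G1] [G'0 G'1] [F0 F1] [F'0 F'1].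
apply: (@le_trans _ _
  (\sum_i \sum_l relent (F l j * G i l) (F' l j * G' i l))%E).
  apply: lee_sum => i _; rewrite !mxE.
  rewrite (eq_bigr (fun l => F l j * G i l)); last by move=> *; rewrite mulrC.
  rewrite [X in log_ratio _ X](eq_bigr (fun l => F' l j * G' i l)); last first.
    by move=> *; rewrite mulrC.
  by apply: log_sum => l; rewrite mulr_ge0.
rewrite exchange_big/= KLE -big_split/=; apply: lee_sum => l _.
by rewrite -KLE KLM// G1 mul1e.
Qed.

End RelativeEntropy.

(** * Column divergences and stochastic matrices *)

Section Stochastic.
Variable R : realType.

Definition colKL m n (A B : 'M[R]_(m, n)) (j : 'I_n) : \bar R :=
  KL (A^~ j) (B^~ j).

Lemma colKL_ge0 m n (A B : 'M[R]_(m, n)) j :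
  stochastic R m n A -> stochastic R m n B -> (0 <= colKL A B j)%E.
Proof. by move=> [A0 A1] [B0 B1]; exact: KL_ge0. Qed.

Lemma colKLxx m n (A : 'M[R]_(m, n)) j :
  (forall i k, 0 <= A i k) -> colKL A A j = 0%E.
Proof. by move=> A0; rewrite /colKL KLE big1// => i _; exact: relentxx. Qed.

Lemma colKL_col_mx m m' n (A B : 'M[R]_(m, n)) (A' B' : 'M[R]_(m', n)) j :
  colKL (col_mx A A') (col_mx B B') j = (colKL A B j + colKL A' B' j)%E.
Proof.
rewrite /colKL !KLE big_split_ord/=.
by congr (_ + _)%E; apply: eq_bigr => i _; rewrite ?col_mxEu ?col_mxEd.
Qed.

Lemma colKL_row_mxl m n n' (A B : 'M[R]_(m, n)) (A' B' : 'M[R]_(m, n')) j :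
  colKL (row_mx A A') (row_mx B B') (lshift n' j) = colKL A B j.
Proof. by apply: eq_bigr => i _; rewrite !row_mxEl. Qed.

Lemma colKL_row_mxr m n n' (A B : 'M[R]_(m, n)) (A' B' : 'M[R]_(m, n')) j :
  colKL (row_mx A A') (row_mx B B') (rshift n j) = colKL A' B' j.
Proof. by apply: eq_bigr => i _; rewrite !row_mxEr. Qed.

Lemma colKL_diagl m n m' n' (A B : 'M[R]_(m, n)) (A' B' : 'M[R]_(m', n')) j :
  colKL (block_mx A 0 0 A') (block_mx B 0 0 B') (lshift n' j) = colKL A B j.
Proof.
rewrite !block_mxEh colKL_row_mxl colKL_col_mx (@colKLxx _ _ 0) ?adde0//.
by move=> *; rewrite mxE.
Qed.

Lemma colKL_diagr m n m' n' (A B : 'M[R]_(m, n)) (A' B' : 'M[R]_(m', n')) j :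
  colKL (block_mx A 0 0 A') (block_mx B 0 0 B') (rshift n j) = colKL A' B' j.
Proof.
rewrite !block_mxEh colKL_row_mxr colKL_col_mx (@colKLxx _ _ 0) ?add0e//.
by move=> *; rewrite mxE.
Qed.

(** Equality holds because the two blocks occupy disjoint sets of rows: each contributes its scaled
    divergence, and the terms in the weights add up to [kl p q]. *)
Lemma colKL_chain m m' (p q : R) (A B : 'M[R]_(m, 1)) (A' B' : 'M[R]_(m', 1)) :
  0 <= p <= 1 -> 0 <= q <= 1 ->
  stochastic R m 1 A -> stochastic R m 1 B ->
  stochastic R m' 1 A' -> stochastic R m' 1 B' ->
  colKL (col_mx (p *: A) ((1 - p) *: A'))
        (col_mx (q *: B) ((1 - q) *: B')) ord0 =
  (kl p q + p%:E * colKL A B ord0 + (1 - p)%:E * colKL A' B' ord0)%E.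
Proof.
move=> /andP[p0 p1] /andP[q0 q1] [A0 A1] [B0 B1] [A'0 A'1] [B'0 B'1].
have colKLZ k (x y : R) (C D : 'M[R]_(k, 1)) : 0 <= x -> 0 <= y ->
    stochastic R k 1 C -> stochastic R k 1 D ->
    colKL (x *: C) (y *: D) ord0 = (relent x y + x%:E * colKL C D ord0)%E.
  move=> x0 y0 [C0 C1] [D0 D1].
  have -> : colKL (x *: C) (y *: D) ord0 =
            KL (fun i => x * C i 0) (fun i => y * D i 0).
    by apply: eq_bigr => i _; rewrite !mxE.
  by rewrite KLM// C1 mul1e.
by rewrite colKL_col_mx !colKLZ ?subr_ge0// addeACA addeA.
Qed.

Lemma stochastic1 n : stochastic R n n 1%:M.
Proof.
split=> [i j|j]; first by rewrite mxE ler0n.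
rewrite (bigD1 j)//= big1 ?addr0 ?mxE ?eqxx// => i ij.
by rewrite mxE (negbTE ij).
Qed.

Lemma stochastic_mul m n k (A : 'M[R]_(m, n)) (B : 'M[R]_(n, k)) :
  stochastic R m n A -> stochastic R n k B -> stochastic R m k (A *m B).
Proof.
move=> [A0 A1] [B0 B1]; split=> [i j|j].
  by rewrite mxE sumr_ge0// => l _; rewrite mulr_ge0.
under eq_bigr do rewrite mxE.
rewrite exchange_big/= -(B1 j); apply: eq_bigr => l _.
by rewrite -mulr_suml A1 mul1r.
Qed.

Lemma stochastic_row_mx m n n' (A : 'M[R]_(m, n)) (B : 'M[R]_(m, n')) :
  stochastic R m (n + n') (row_mx A B) <->
  stochastic R m n A /\ stochastic R m n' B.
Proof.
split=> [[AB0 AB1]|[[A0 A1] [B0 B1]]].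
  split; split=> [i j|j].
  - by have := AB0 i (lshift n' j); rewrite row_mxEl.
  - by rewrite -(AB1 (lshift n' j)); apply: eq_bigr => i _; rewrite row_mxEl.
  - by have := AB0 i (rshift n j); rewrite row_mxEr.
  - by rewrite -(AB1 (rshift n j)); apply: eq_bigr => i _; rewrite row_mxEr.
split=> [i j|j]; case: (split_ordP j) => k ->.
- by rewrite row_mxEl.
- by rewrite row_mxEr.
- by rewrite -(A1 k); apply: eq_bigr => i _; rewrite row_mxEl.
- by rewrite -(B1 k); apply: eq_bigr => i _; rewrite row_mxEr.
Qed.

Lemma stochastic_col_mx0 m m' n (A : 'M[R]_(m, n)) :
  stochastic R m n A -> stochastic R (m + m') n (col_mx A 0).
Proof.
move=> [A0 A1]; split=> [i j|j].
  by case: (split_ordP i) => k ->; rewrite ?col_mxEu ?col_mxEd// mxE.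
rewrite big_split_ord/= [X in _ + X]big1 ?addr0 => [|i _]; last first.
  by rewrite col_mxEd mxE.
by rewrite -(A1 j); apply: eq_bigr => i _; rewrite col_mxEu.
Qed.

Lemma stochastic_col_0mx m m' n (A : 'M[R]_(m', n)) :
  stochastic R m' n A -> stochastic R (m + m') n (col_mx 0 A).
Proof.
move=> [A0 A1]; split=> [i j|j].
  by case: (split_ordP i) => k ->; rewrite ?col_mxEu ?col_mxEd// mxE.
rewrite big_split_ord/= [X in X + _]big1 ?add0r => [|i _]; last first.
  by rewrite col_mxEu mxE.
by rewrite -(A1 j); apply: eq_bigr => i _; rewrite col_mxEd.
Qed.

Lemma stochastic_rows_gt0 m n (A : 'M[R]_(m, n)) :
  stochastic R m n A -> (0 < n)%N -> (0 < m)%N.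
Proof.
case: m A => // A [_ A1]; case: n A A1 => // n A A1 _.
by have /eqP := A1 ord0; rewrite big_ord0 eq_sym oner_eq0.
Qed.

(** Here [p] is the first entry and [v] the remaining ones, renormalised. *)
Lemma stochastic_col_split m (u : 'M[R]_(1 + m.+1, 1)) :
  stochastic R (1 + m.+1) 1 u ->
  exists p (v : 'M[R]_(m.+1, 1)), [/\ 0 <= p <= 1, stochastic R m.+1 1 v &
    u = col_mx (p *: 1%:M) ((1 - p) *: v)].
Proof.
move=> [u0 u1]; set p := u ord0 ord0; set w : 'cV_m.+1 := dsubmx u.
have w0 i j : 0 <= w i j by rewrite mxE.
have uE : u = col_mx (p *: 1%:M) w.
  rewrite -[LHS]vsubmxK; congr col_mx; apply/matrixP => i j.
  by rewrite !ord1 !mxE mulr1 lshift0.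
have w1 : \sum_i w i 0 = 1 - p.
  rewrite -(u1 0) big_split_ord/= big_ord1 lshift0 addrAC subrr add0r.
  by apply: eq_bigr => i _; rewrite mxE.
have p1 : 0 <= 1 - p by rewrite -w1; apply: sumr_ge0.
have p01 : 0 <= p <= 1 by rewrite u0 -subr_ge0.
(* If [p = 1], the tail is zero and cannot be renormalised; its coefficient is 0, so a Dirac mass
   serves as [v]. *)
have [p_eq1|pn1] := eqVneq (1 - p) 0.
  exists p, (col_mx 1%:M (0 : 'M[R]_(m, 1))); split=> //.
    exact: (@stochastic_col_mx0 1 m 1 _ (stochastic1 1)).
  rewrite uE p_eq1 scale0r; congr col_mx; apply/matrixP => i j.
  by rewrite [RHS]mxE ord1; rewrite p_eq1 in w1; exact: psumr_eq0P w1 _ _.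
exists p, ((1 - p)^-1 *: w); split=> //; last first.
  by rewrite scalerA divff// scale1r -uE.
split=> [i j|j]; first by rewrite mxE mulr_ge0 ?invr_ge0.
by under eq_bigr do rewrite mxE; rewrite -mulr_sumr ord1 w1 mulVf.
Qed.

Lemma KLmax_ge0 m n (A B : 'M[R]_(m, n)) :
  stochastic R m n A -> stochastic R m n B -> (0 <= KLmax A B)%E.
Proof.
move=> sA sB; rewrite /KLmax; case: ifPn => // /norP[].
case: n A B sA sB => // n A B sA sB _ _; apply: le_trans (colKL_ge0 ord0 sA sB) _.
exact: (le_bigmax _ (colKL A B)).
Qed.

Lemma colKL_le_KLmax m n (A B : 'M[R]_(m, n)) j :
  stochastic R m n A -> (colKL A B j <= KLmax A B)%E.
Proof.
(* The index [j] forces a column, and a stochastic column needs a row, so the default value 0 of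
   [KLmax] does not occur. *)
move=> sA; have n0 : (0 < n)%N by case: (n) j => // -[].
rewrite /KLmax !gtn_eqF//; last exact: stochastic_rows_gt0 sA n0.
exact: (le_bigmax _ (colKL A B)).
Qed.

Lemma KLmax_le m n (A B : 'M[R]_(m, n)) e : (0 <= e)%E ->
  (forall j, colKL A B j <= e)%E -> (KLmax A B <= e)%E.
Proof.
move=> e0 h; rewrite /KLmax; case: ifP => // _.
by apply: bigmax_le => [|j _]; [rewrite leNye|exact: h].
Qed.

End Stochastic.

(** * Interpretation of terms as stochastic matrices *)

Section Semantics.
Variable R : realType.
Local Open Scope tm_scope.

Lemma sem_stochastic n m (f : term R n m) : stochastic R m n (sem f).
Proof.
elim: f => {n m} [||p|n|n m|n m k f Hf g Hg|n m n' m' f Hf g Hg] /=.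
- by split=> [i []|[]].
- by split=> [i j|j]; rewrite ?big_ord1 mxE.
- split=> [i j|j]; first by rewrite mxE; case: ifP => _; rewrite ?subr_ge0.
  by rewrite !big_ord_recl big_ord0 !mxE/= addr0 addrCA subrr addr0.
- exact: stochastic1.
- rewrite block_mxEh stochastic_row_mx; split.
    exact/stochastic_col_0mx/stochastic1.
  exact/stochastic_col_mx0/stochastic1.
- exact: stochastic_mul.
- rewrite block_mxEh stochastic_row_mx; split.
    exact: stochastic_col_mx0.
  exact: stochastic_col_0mx.
Qed.

Lemma sem_chain n m (p : {i01 R}) (f : term R 1 n) (g : term R 1 m) :
  sem (Conv p ;; (f ⊗ g)) =
  col_mx (p%:num *: sem f) ((1 - p%:num) *: sem g) :> 'M[R]_(_, 1).
Proof.
rewrite /=.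
(* The column of [Conv p] is read as two 1 x 1 blocks, so that block multiplication applies. *)
have -> : \col_(i < 2) (if i == ord0 then p%:num else 1 - p%:num) =
          col_mx (p%:num%:M) ((1 - p%:num)%:M) :> 'M[R]_(1 + 1, 1).
  apply/matrixP => i j; rewrite ord1; case: (split_ordP i) => k ->.
    by rewrite col_mxEu !ord1 !mxE lshift0.
  by rewrite col_mxEd !ord1 !mxE.
have := mul_block_col (sem f) 0 0 (sem g) (p%:num%:M) (1 - p%:num)%:M.
by rewrite !mul_mx_scalar !scaler0 addr0 add0r.
Qed.

End Semantics.

(** * Soundness of the derivation rules *)

Section Soundness.
Variables (R : realType) (E : equations R).
Hypothesis hE : axiomatises_stochastic E.

(** The invariant of the induction on derivations. Bounding every column avoids the case distinction
    in [KLmax]; nonnegativity of indices is carried along since the budgets of two premises are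
    added. *)
Definition valid n m (J : judgment R n m) : Prop :=
  match J with
  | JEq f g => eqmod E f g
  | JQEq e f g => (0 <= e)%E /\ forall j, (colKL (sem f) (sem g) j <= e)%E
  end.

Lemma derivable_valid n m (J : judgment R n m) : Defs.derivable E J -> valid J.
Proof.
have prob (p : {i01 R}) : 0 <= p%:num <= (1 : R) by apply/andP; split.
have nonneg k l (f : term R k l) i j : 0 <= sem f i j.
  by have [] := sem_stochastic f.
elim=> {n m J} /=.
- by move=> *; exact: eqmod_ax.
- by move=> *; exact: eqmod_law.
- by move=> *; exact: eqmod_refl.
- by move=> *; exact: eqmod_sym.
- by move=> n m f g h _ fg _ gh; exact: eqmod_trans gh.
- by move=> *; exact: eqmod_seq.
- by move=> *; exact: eqmod_par.
- by move=> n m f; split=> // j; rewrite colKLxx.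
- move=> n m f g f' g' p q e d _ [e0 fg] _ [d0 fg'].
  have le_d : (colKL (sem (Conv p ;; (f ⊗ f'))%tm)
                     (sem (Conv q ;; (g ⊗ g'))%tm) ord0 <=
      kl p%:num q%:num + p%:num%:E * e + (1 - p%:num)%:E * d)%E.
    rewrite !sem_chain colKL_chain//; try exact: sem_stochastic.
    apply: leeD; first by apply: leeD2l; rewrite lee_wpmul2l ?lee_fin.
    by rewrite lee_wpmul2l// lee_fin subr_ge0.
  (* The index dominates a divergence of stochastic columns, hence is nonnegative. *)
  split=> [|j]; last by rewrite ord1.
  by apply: le_trans le_d; apply: colKL_ge0; exact: sem_stochastic.
- move=> n m n' m' f g f' g' e d _ [e0 fg] _ [d0 fg'].
  split=> [|j]; rewrite le_max ?e0//.
  case: (split_ordP j) => k ->; rewrite ?colKL_diagl ?colKL_diagr.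
    by rewrite fg.
  by rewrite fg' orbT.
- by move=> n m f f' g g' e _ /hE ff' _ /hE gg' _ [e0 fg]; rewrite -ff' -gg'.
- move=> n m f g e e' ee' _ [e0 fg].
  by split=> [|j]; [exact: le_trans ee'|exact: le_trans (fg j) ee'].
- move=> n m f g I e _ fg; split=> [|j]; apply: le_ereal_inf_tmp => _ [i _ <-].
    by have [] := fg i.
  by have [_] := fg i.
- move=> n m k f f' g g' e d _ [e0 fg] _ [d0 fg'].
  split=> [|j]; first exact: adde_ge0.
  have [[F0 F1] sF'] := (sem_stochastic f, sem_stochastic f').
  apply: le_trans (KL_mulmx j _ _ (conj F0 F1) sF') _;
    try exact: sem_stochastic.
  apply: leeD; first exact: fg.
  (* An average of divergences bounded by [d], with weights summing to 1, is at most [d]. *)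
  apply: (@le_trans _ _ (\sum_l (sem f l j)%:E * d)%E).
    by apply: lee_sum => l _; rewrite lee_wpmul2l ?lee_fin//; exact: fg'.
  rewrite -ge0_sume_distrl; last by move=> *; rewrite lee_fin.
  by rewrite sumEFin F1 mul1e.
- move=> n m n' m' f f' g g' e d _ [e0 fg] _ [d0 fg'].
  split=> [|j]; first exact: adde_ge0.
  case: (split_ordP j) => k ->; rewrite ?colKL_diagl ?colKL_diagr.
    by apply: le_trans (fg k) _; rewrite leeDl.
  by apply: le_trans (fg' k) _; rewrite leeDr.
Qed.

Lemma derivable_eqmod n m (f g : term R n m) :
  eqmod E f g -> Defs.derivable E (JEq f g).
Proof.
elim=> {n m f g}.
- by move=> *; exact: d_ax.
- by move=> *; exact: d_law.
- by move=> *; exact: d_refl.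
- by move=> *; exact: d_sym.
- by move=> n m f g h _ fg _ gh; exact: d_trans gh.
- by move=> *; exact: d_seq.
- by move=> *; exact: d_par.
Qed.

(** No quantitative rule concludes an equality, so derivable equality is [eqmod E], which [hE]
    identifies with equality of matrices. *)
Lemma derivable_eqP n m (f g : term R n m) :
  Defs.derivable E (JEq f g) <-> sem f = sem g.
Proof.
split=> [/derivable_valid/hE//|/hE]; exact: derivable_eqmod.
Qed.

End Soundness.

(** * Terms for functions between finite sets *)

Section Wirings.
Variable R : realType.
Local Open Scope tm_scope.

(** The matrix of [f] is the 0-1 matrix of [phi]. Taking [phi] on [nat] rather than on ordinals
    avoids casts between sums of arities. *)
Definition graph n m (f : term R n m) (phi : nat -> nat) : Prop :=
  (forall j, (j < n)%N -> (phi j < m)%N) /\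
  (forall i j, sem f i j = (val i == phi j)%:R).

Lemma eq_graph n m (f : term R n m) phi psi :
  (forall j, (j < n)%N -> phi j = psi j) -> graph f phi -> graph f psi.
Proof.
move=> phipsi [fm fE]; split=> [j jn|i j]; first by rewrite -phipsi ?fm.
by rewrite fE phipsi.
Qed.

Lemma graph_Id n : graph (Id n) id.
Proof. by split=> // i j; rewrite mxE. Qed.

Lemma graph_Mu : graph Mu (fun=> 0%N).
Proof. by split=> // i j; rewrite ord1 mxE. Qed.

Lemma graph_Swap n m :
  graph (Swap n m) (fun j => if (j < n)%N then (m + j)%N else (j - n)%N).
Proof.
split=> [j|i j]; first by case: ifP; lia.
rewrite /=; case: (split_ordP i) => k ->; case: (split_ordP j) => l ->.
- rewrite block_mxEul mxE/=; case: eqP => //; have := ltn_ord k; lia.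
- rewrite block_mxEur mxE/= addKn.
  by congr (_%:R).
- by rewrite block_mxEdl mxE/= eqn_add2l.
- rewrite block_mxEdr mxE/= addKn; case: eqP => //.
  by have := ltn_ord l; lia.
Qed.

Lemma graph_Seq n m k (f : term R n m) (g : term R m k) phi psi :
  graph f phi -> graph g psi -> graph (f ;; g) (psi \o phi).
Proof.
move=> [fm fE] [gk gE]; split=> [j jn|i j]; first exact/gk/fm.
rewrite /= mxE (bigD1 (Ordinal (fm j (ltn_ord j))))//= big1 ?addr0.
  by rewrite gE fE/= eqxx mulr1.
by move=> l; rewrite -val_eqE/= => /negbTE lj; rewrite fE lj mulr0.
Qed.

Lemma graph_Par n m n' m' (f : term R n m) (g : term R n' m') phi psi :
  graph f phi -> graph g psi ->
  graph (f ⊗ g) (fun j => if (j < n)%N then phi j else (m + psi (j - n))%N).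
Proof.
move=> [fm fE] [gm gE]; split=> [j jn|i j].
  case: ifP => [/fm|]; first lia.
  by move=> jn'; have := gm (j - n)%N; lia.
rewrite /=; case: (split_ordP i) => k ->; case: (split_ordP j) => l ->.
- by rewrite block_mxEul fE.
- rewrite block_mxEur mxE/=.
  by case: eqP => //; have := ltn_ord k; lia.
- rewrite block_mxEdl mxE/=; case: eqP => //.
  by have := fm l (ltn_ord l); lia.
- by rewrite block_mxEdr gE/= addKn eqn_add2l.
Qed.

(** The first wire is merged into wire [i] of the others: by [Mu] if [i = 0], otherwise by swapping
    it past one wire and recursing. *)
Lemma graph_join1 m i : (i < m)%N ->
  exists f : term R (1 + m) m, graph f (fun j => if j is j'.+1 then j' else i).
Proof.
elim: m i => // m IH [_|i /IH[f fi]].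
  exists ((Mu ⊗ Id m) : term R (1 + (1 + m)) (1 + m)).
  apply: eq_graph (graph_Par graph_Mu (graph_Id m)) => -[|[|j]] //=.
  by rewrite subn2.
exists (((Swap 1 1 ⊗ Id m) : term R (1 + (1 + m)) (1 + (1 + m)))
          ;; (Id 1 ⊗ f)).
apply: eq_graph (graph_Seq (graph_Par (graph_Swap 1 1) (graph_Id m))
  (graph_Par (graph_Id 1) fi)) => -[|[|j]] //=.
by rewrite subn2.
Qed.

(** The first [n] wires are merged into the last [m] one at a time. An arbitrary [phi] is allowed
    because setting the first wire aside replaces it by [phi \o S]. *)
Lemma graph_join n m (phi : nat -> nat) :
  (forall j, (j < n)%N -> (phi j < m)%N) ->
  exists f : term R (n + m) m,
    graph f (fun j => if (j < n)%N then phi j else (j - n)%N).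
Proof.
elim: n phi => [|n IH] phi phim.
  by exists (Id m); apply: eq_graph (graph_Id m) => j _; rewrite subn0.
have [|f fphi] := IH (phi \o S); first by move=> j jn; exact: phim.
have [g gphi] := graph_join1 (phim 0%N isT).
exists (((Id 1 ⊗ f) : term R (1 + (n + m)) (1 + m)) ;; g).
apply: eq_graph (graph_Seq (graph_Par (graph_Id 1) fphi) gphi) => -[|j] //= _.
by rewrite subn1/= ltnS subSS.
Qed.

(** The codiagonal; after a parallel product it lays two blocks of columns side by side. *)
Lemma exists_merge m :
  exists f : term R (m + m) m, sem f = row_mx 1%:M 1%:M.
Proof.
have [//|f [_ fE]] := @graph_join m m id.
exists f; apply/matrixP => i j; rewrite fE.
case: (split_ordP j) => k ->; first by rewrite row_mxEl mxE.
by rewrite row_mxEr mxE/= addKn.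
Qed.

Lemma inhabited_term0 m : inhabited (term R 0 m).
Proof.
elim: m => [|m [f]]; first exact: (inhabits (Id 0)).
exact: (inhabits ((Eta ⊗ f) : term R (0 + 0) (1 + m))).
Qed.

End Wirings.

(** * Completeness: deriving the exact divergence *)

Section Completeness.
Variables (R : realType) (E : equations R).
Local Open Scope tm_scope.

Lemma derivable_column m (u v : 'M[R]_(m, 1)) :
  stochastic R m 1 u -> stochastic R m 1 v ->
  exists f g : term R 1 m, [/\ sem f = u, sem g = v &
    Defs.derivable E (JQEq (colKL u v ord0) f g)].
Proof.
elim: m u v => [|[|m] IH] u v su sv.
- by have := stochastic_rows_gt0 su isT.
- have ones (w : 'M[R]_(1, 1)) : stochastic R 1 1 w -> w = 1%:M.
    move=> [_ /(_ 0)]; rewrite big_ord1 => w1.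
    by apply/matrixP => i j; rewrite !ord1 w1 mxE.
  exists (Id 1), (Id 1); rewrite (ones _ su) (ones _ sv); split=> //.
  rewrite colKLxx; first exact: q_refl.
  by have [] := stochastic1 R 1.
have [p [u' [p01 su' ->]]] := stochastic_col_split su.
have [q [v' [q01 sv' ->]]] := stochastic_col_split sv.
have [f [g [fE gE fg]]] := IH _ _ su' sv'.
have [/andP[p0 p1] /andP[q0 q1]] := (p01, q01).
exists ((Conv (Itv01 p0 p1) ;; (Id 1 ⊗ f)) : term R 1 (1 + m.+1)).
exists ((Conv (Itv01 q0 q1) ;; (Id 1 ⊗ g)) : term R 1 (1 + m.+1)).
split.
- by rewrite -fE; exact: (sem_chain (Itv01 p0 p1) (Id 1) f).
- by rewrite -gE; exact: (sem_chain (Itv01 q0 q1) (Id 1) g).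
have s1 := stochastic1 R 1.
have := colKL_chain p01 q01 s1 s1 su' sv'.
(* The Dirac part [Id 1] has divergence 0, the index given by [q_refl]; the index of (Chain) is then
   exactly the divergence of the columns. *)
rewrite (colKLxx _ (proj1 s1)) => klE.
have := q_chain (Itv01 p0 p1) (Itv01 q0 q1) (q_refl E (Id 1)) fg.
by rewrite -klE.
Qed.

(** A single bound [e] for all columns, rather than their maximum, makes the induction on columns
    uniform. *)
Lemma derivable_matrix n m (A B : 'M[R]_(m, n)) (e : \bar R) :
  stochastic R m n A -> stochastic R m n B ->
  (0 <= e)%E -> (forall j, (colKL A B j <= e)%E) ->
  exists f g : term R n m, [/\ sem f = A, sem g = B &
    Defs.derivable E (JQEq e f g)].
Proof.
move=> + + e0; elim: n A B => [|n IH] A B.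
  move=> _ _ _; have [f] := inhabited_term0 R m.
  exists f, f; split; [by apply/matrixP => i [] ..|].
  exact: q_mono e0 (q_refl E f).
(* The first column is split off from each matrix. *)
rewrite -[A](@hsubmxK _ m 1 n) -[B](@hsubmxK _ m 1 n).
move: (@lsubmx _ m 1 n A) (@rsubmx _ m 1 n A) => a {}A.
move: (@lsubmx _ m 1 n B) (@rsubmx _ m 1 n B) => b {}B.
move=> /(stochastic_row_mx a A)[sa sA] /(stochastic_row_mx b B)[sb sB] le_e.
have [f [g [fa gb fg]]] := derivable_column sa sb.
have [j|F [G [FA GB FG]]] := IH A B sA sB.
  by rewrite -(colKL_row_mxr a b).
have [h hE] := exists_merge R m.
have semE (k : term R 1 m) (K : term R n m) :
    sem (((k ⊗ K) ;; h) : term R (1 + n) m) = row_mx (sem k) (sem K).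
  by rewrite /= hE mul_row_block !mul1mx addr0 add0r.
exists (((f ⊗ F) ;; h) : term R (1 + n) m).
exists (((g ⊗ G) ;; h) : term R (1 + n) m).
split; first by rewrite semE fa FA.
  by rewrite semE gb GB.
have fg_e : Defs.derivable E (JQEq e f g).
  by apply: q_mono fg; rewrite -(colKL_row_mxl a b A B).
(* (Parmax) gives [maxe e e = e], and the shared codiagonal adds 0. *)
have := q_seq (q_parmax fg_e FG) (q_refl E h).
by rewrite maxxx adde0.
Qed.

End Completeness.

(** * The syntactic category: bijection and isometry *)

Lemma syn_classP (R : realType) (E : equations R) n m (f g : term R n m) :
  syn_class E f = syn_class E g <-> Defs.derivable E (JEq f g).
Proof.
split=> [/(eqmodP (syn_equiv E n m))/asboolP//|fg].
by apply/(eqmodP (syn_equiv E n m))/asboolP.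
Qed.

Theorem theorem4p8 (R : realType) (E : equations R)
    (hE : axiomatises_stochastic E) (n m : nat) :
  (exists Phi : Syn E n m -> 'M[R]_(m, n),
     (forall f : term R n m, Phi (syn_class E f) = sem f) /\
     set_bij [set: Syn E n m]%classic (stochastic R m n) Phi) /\
  (forall f g : term R n m, dKL E f g = KLmax (sem f) (sem g)).
Proof.
split.
  exists (fun x => sem (repr x)); split=> [f|].
    by apply/(derivable_eqP hE)/syn_classP; rewrite /syn_class reprK.
  split=> [x _|x y _ _ /(derivable_eqP hE)/syn_classP|A sA].
  - exact: sem_stochastic.
  - by rewrite /syn_class !reprK.
  (* Surjectivity: [A] is compared with itself under the trivial bound [+oo], only to obtain a term
     for it. *)
  have [|f [_ [fA _ _]]] := derivable_matrix E sA sA (leey 0).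
    by move=> j; rewrite leey.
  exists (syn_class E f) => //; rewrite -fA.
  by apply/(derivable_eqP hE)/syn_classP; rewrite /syn_class reprK.
move=> f g; have [sf sg] := (sem_stochastic f, sem_stochastic g).
apply/eqP; rewrite eq_le; apply/andP; split.
  apply: ereal_inf_lbound; split; first exact: KLmax_ge0.
  (* The terms [f'] and [g'] have the matrices of [f] and [g], hence are provably equal to them, and
     the derivation transfers by replacement. *)
  have [|f' [g' [fE gE fg]]] := derivable_matrix E sf sg (KLmax_ge0 sf sg).
    by move=> j; exact: colKL_le_KLmax.
  by apply: q_repl fg; exact/(derivable_eqP hE).
(* Conversely, by soundness every derivable index bounds all column divergences. *)
apply: le_ereal_inf_tmp => e [e0 /(derivable_valid hE)[_ fg]].
exact: KLmax_le.
Qed.
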